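(* Let $A$ be a commutative domain, let $K$ be the field of fractions of $A$, and let $L\subseteq \mathrm{Der}(A)$ be a Lie ring that consists of locally nilpotent derivations. Suppose that $\dim_K KL<\infty$. Then the Lie ring $L$ is locally nilpotent.
   Context: $\mathrm{Der}(A)$ is the Lie ring of derivations of $A$ under the commutator bracket. Every derivation of $A$ extends uniquely to a derivation of $K$, so $\mathrm{Der}(A)\subseteq\mathrm{Der}(K)$; the Lie ring $\mathrm{Der}(K)$ is a vector space over $K$ via $(kd)(x)=k\,d(x)$, and $KL$ denotes the $K$-linear span of $L$ in $\mathrm{Der}(K)$. A Lie ring $L\subseteq\mathrm{Der}(A)$ is an additive subgroup closed under the bracket. A derivation $d$ of $A$ is locally nilpotent if for every $a\in A$ there is an integer $n(a)\ge 1$ with $d^{n(a)}(a)=0$. A Lie ring is locally nilpotent if every finitely generated Lie subring is nilpotent. *)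

(* Defs.v *)
From HB Require Import structures.
From mathcomp Require Import all_boot all_algebra.
From mathcomp Require Import ring.
From mathcomp Require Import boolp classical_sets functions cardinality.

Set Implicit Arguments.
Unset Strict Implicit.
Unset Printing Implicit Defensive.

Import GRing.Theory.
Local Open Scope classical_set_scope.
Local Open Scope ring_scope.

Section Derivations.
Variable R : comPzRingType.

Definition derivation (d : R -> R) : Prop :=
  zmod_morphism d /\ forall x y, d (x * y) = d x * y + x * d y.

Definition Der : set (R -> R) := [set d | derivation d].

Definition locally_nilpotent_map (d : R -> R) : Prop :=
  forall a, exists2 n, (1 <= n)%N & iter n d a = 0.

End Derivations.

Arguments Der : clear implicits.

(* Lie rings are handled concretely, as sets of maps V -> V closed under the  *)
(* commutator bracket.  The bracket is biadditive, alternating and satisfies  *)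
(* the Jacobi identity on additive maps, hence on any subset of Der R; the    *)
(* notions below are only meant for such sets.                                *)
Section LieRings.
Variable V : zmodType.
Implicit Types (L M X Y : set (V -> V)).

Definition bracket (f g : V -> V) : V -> V := (f \o g) - (g \o f).

Definition additive_subgroup X : Prop :=
  X 0 /\ forall f g, X f -> X g -> X (f - g).

Definition lie_ring L : Prop :=
  additive_subgroup L /\ forall f g, L f -> L g -> L (bracket f g).

Definition lie_gen X : set (V -> V) := smallest lie_ring X.

Definition finitely_generated L : Prop :=
  exists2 S, finite_set S & L = lie_gen S.

Definition commutator X Y : set (V -> V) :=
  smallest additive_subgroup [set bracket x y | x in X & y in Y].

(* lower_central L n is the (n+1)-st term of the lower central series of L.   *)
Fixpoint lower_central L n : set (V -> V) :=
  if n is n'.+1 then commutator (lower_central L n') L else L.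

Definition nilpotent_lie_ring L : Prop :=
  exists n, lower_central L n = [set 0].

Definition locally_nilpotent_lie_ring L : Prop :=
  forall M, lie_ring M -> M `<=` L -> finitely_generated M ->
    nilpotent_lie_ring M.

End LieRings.

Lemma lie_ring_Der (R : comPzRingType) : lie_ring (Der R).
Proof.
split; [split|].
- have z x : (0 : R -> R) x = 0 by [].
  by split=> x y; rewrite !z ?subrr // mul0r mulr0 addr0.
- by move=> f g [fB fM] [gB gM]; split=> x y;
     rewrite !fctE ?fB ?gB ?fM ?gM; ring.
- move=> f g [fB fM] [gB gM].
  have D (h : R -> R) : zmod_morphism h -> {morph h : x y / x + y}.
    move=> hB x y; have h0 : h 0 = 0 by have := hB 0 0; rewrite !subrr.
    by rewrite -{1}[y]opprK hB -[- y]sub0r hB h0 sub0r opprK.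
  have [fD gD] := (D f fB, D g gB).
  by split=> x y; rewrite /bracket !fctE /= !(fB, gB, fM, gM, fD, gD); ring.
Qed.

Section LinearSpan.
Variables (K : fieldType) (V : lmodType K).

Definition lin_span (S : set V) : set V :=
  [set v | exists n (c : 'I_n -> K) (e : 'I_n -> V),
     (forall i, S (e i)) /\ v = \sum_(i < n) c i *: e i].

Definition finite_dimensional (W : set V) : Prop :=
  exists n (e : 'I_n -> V), (forall i, W (e i)) /\ W `<=` lin_span (range e).

End LinearSpan.

Section QuotientRule.
Variable F : fieldType.
Implicit Types a b da db : F.

Definition quot_rule a b da db : F := (da * b - a * db) / b ^+ 2.

Lemma quot_ruleE (D : F -> F) a b : Der F D -> b != 0 ->
  D (a / b) = quot_rule a b (D a) (D b).
Proof.
move=> [_ DM] b0; have := DM (a / b) b; rewrite mulfVK // /quot_rule => ->.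
by field.
Qed.

Lemma quot_rule_wd a b da db a' b' da' db' : b != 0 -> b' != 0 ->
  a * b' = a' * b -> da * b' + a * db' = da' * b + a' * db ->
  quot_rule a b da db = quot_rule a' b' da' db'.
Proof.
move=> b0 b'0 e1 e2; apply/eqP; rewrite /quot_rule eqr_div ?expf_neq0 //.
rewrite -subr_eq0; apply/eqP.
transitivity (b * b' * ((da * b' + a * db') - (da' * b + a' * db))
              - (db * b' + b * db') * (a * b' - a' * b)); first by ring.
by rewrite e1 e2 !subrr !mulr0 subrr.
Qed.

Lemma quot_ruleB a b da db a' b' da' db' : b != 0 -> b' != 0 ->
  quot_rule (a * b' - a' * b) (b * b')
    (da * b' + a * db' - (da' * b + a' * db)) (db * b' + b * db') =
  quot_rule a b da db - quot_rule a' b' da' db'.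
Proof. by move=> b0 b'0; rewrite /quot_rule; field; rewrite b0 b'0. Qed.

Lemma quot_ruleM a b da db a' b' da' db' : b != 0 -> b' != 0 ->
  quot_rule (a * a') (b * b') (da * a' + a * da') (db * b' + b * db') =
  quot_rule a b da db * (a' / b') + a / b * quot_rule a' b' da' db'.
Proof. by move=> b0 b'0; rewrite /quot_rule; field; rewrite b0 b'0. Qed.

Lemma subf_div a b a' b' : b != 0 -> b' != 0 ->
  a / b - a' / b' = (a * b' - a' * b) / (b * b').
Proof. by move=> b0 b'0; field; rewrite b0 b'0. Qed.

End QuotientRule.

Section FractionField.
Variable A : idomainType.
Local Notation K := {fraction A}.

Definition extends_to_frac (d : A -> A) (D : K -> K) : Prop :=
  forall a, D (tofrac a) = tofrac (d a).

(* The copy of L in Der(K); see der_extends_uniquely.                         *)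
Definition frac_ext (L : set (A -> A)) : set (K -> K) :=
  [set D | Der K D /\ exists2 d, L d & extends_to_frac d D].

(* KL; the codomain K^o gives K -> K its pointwise K-vector space structure,  *)
(* (k *: d) x = k * d x.                                                      *)
Definition frac_span (L : set (A -> A)) : set (K -> K^o) :=
  lin_span (frac_ext L : set (K -> K^o)).

Lemma fracP (x : K) : exists a b : A, b != 0 /\ x = tofrac a / tofrac b.
Proof.
elim/quotW: x => r; exists \n_r, \d_r; split; first exact: denom_ratioP.
have b0 : tofrac \d_r != 0 :> K by rewrite tofrac_eq0 denom_ratioP.
apply: (mulIf b0); rewrite mulfVK //.
unlock FracField.tofrac; rewrite -[LHS]FracField.pi_mul.
apply/eqmodP; rewrite /= FracField.equivfE /FracField.mulf.
by rewrite !numden_Ratio ?mulf_neq0 ?oner_eq0 ?denom_ratioP //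
           !mulr1 mulrC.
Qed.

Lemma der_extends_uniquely (d : A -> A) : Der A d ->
  exists! D : K -> K, Der K D /\ extends_to_frac d D.
Proof.
move=> [dB dM].
have /choice [nd ndP] : forall x : K, exists p : A * A,
    p.2 != 0 /\ x = tofrac p.1 / tofrac p.2.
  by move=> x; have [a [b ?]] := fracP x; exists (a, b).
pose q (a b : A) : K :=
  quot_rule (tofrac a) (tofrac b) (tofrac (d a)) (tofrac (d b)).
pose D x := q (nd x).1 (nd x).2.
have f0 (b : A) : b != 0 -> tofrac b != 0 :> K by rewrite tofrac_eq0.
have DE (a b : A) : b != 0 -> D (tofrac a / tofrac b) = q a b.
  move=> b0; have [] := ndP (tofrac a / tofrac b); rewrite /D.
  case: (nd _) => a' b' /= b'0 /eqP; rewrite eqr_div ?f0 // => /eqP e.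
  have /(congr1 d) : a * b' = a' * b.
    by apply/eqP; rewrite -tofrac_eq !tofracM e.
  rewrite !dM => /(congr1 (@tofrac A)); rewrite !tofracD !tofracM => e2.
  apply/esym/quot_rule_wd; rewrite ?f0 //.
have d1 : d 1 = 0.
  have := dM 1 1; rewrite !mul1r mulr1 => /(congr1 (fun z => z - d 1)).
  by rewrite addrK subrr => <-.
exists D; split; first (split; first split).
- move=> x y; have [a [b [b0 ->]]] := fracP x.
  have [a' [b' [b'0 ->]]] := fracP y.
  rewrite subf_div ?f0 // -!tofracM -tofracB !DE ?mulf_neq0 // /q.
  by rewrite -quot_ruleB ?f0 // !(dB, dM) !(tofracB, tofracD, tofracM).
- move=> x y; have [a [b [b0 ->]]] := fracP x.
  have [a' [b' [b'0 ->]]] := fracP y.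
  rewrite mulf_div -!tofracM !DE ?mulf_neq0 // /q.
  by rewrite -quot_ruleM ?f0 // !dM !(tofracD, tofracM).
- move=> a; have := DE a 1 (oner_neq0 _); rewrite tofrac1 divr1 => ->.
  by rewrite /q /quot_rule d1 tofrac0 tofrac1 mulr0 subr0 mulr1 expr1n divr1.
move=> E [EK Ed]; apply/funext => x.
have [a [b [b0 ->]]] := fracP x.
by rewrite DE // (quot_ruleE _ EK) ?f0 // !Ed.
Qed.

End FractionField.

(* Main.v *)
Require Import Defs.
From mathcomp Require Import all_boot all_algebra.
From mathcomp Require Import ring.
From mathcomp Require Import boolp classical_sets functions cardinality.
Import GRing.Theory.
Local Open Scope classical_set_scope.
Local Open Scope ring_scope.

Set Implicit Arguments.
Unset Strict Implicit.
Unset Printing Implicit Defensive.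

(** The proof is elementary and independent of the characteristic.

   Local nilpotency of the derivations on A makes L an Engel ring: finitely
   many points of A separate the elements of KL, and the value of
   (ad d)^k x at a given point vanishes for large k
   ([Engel_of_separating_points]).  From then on only the copy of L inside
   Der(K) matters.

   Local nilpotency of a subring M of an Engel ring L0 is handled in the form
   [jointly_nilpotent]: for every finite subset S of M and every x in L0, all
   sufficiently long words in ad S kill x.  This property passes to unions of
   chains, hence maximal jointly nilpotent subrings exist, and it passes from M
   to M + Zx when x normalises M ([jointly_nilpotent_extend]).  So it is enough
   to show, as in the proof of Engel's theorem, that a maximal jointly
   nilpotent subring M different from L does not contain all x in L with
   [M, x] inside M.  This is done by induction on dim KL.

   The tool is [common_zero]: if M acts by semilinear operators on a K-space of
   finite dimension modulo Y and preserves a set X not inside Y, then some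
   x in X outside Y is sent into Y by all of M.  Any finite part of M has
   such an x, by joint nilpotency; vectors x_i chosen for growing finite parts,
   each moved out of Y by an operator that sends the later ones into Y, are
   linearly independent modulo Y, so there are only finitely many.

   If L is not inside KM ([normaliser_grows_span]), then by induction the ring
   of elements of L in KM is jointly nilpotent, hence equals M, and a common
   zero of M on L modulo KM normalises M.

   If L is inside KM ([normaliser_grows_full]), repeated use of [common_zero]
   gives an M-invariant hyperplane W of KM, spanned by elements of M, and e in
   M with KM = W + Ke and [M, e] inside W.  The coefficient lam(x) of e in x is
   then M-equivariant: lam [m, x] = m (lam x).  Let C be the field of elements
   of K killed by M.  The x in L with lam(x) in C form a ring containing M whose
   commutators lie in W; as the elements of L in W are jointly nilpotent by
   induction, so is this ring, which is therefore M.  Finally [common_zero],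
   applied to the exact one-forms d(lam x) with the Lie derivative, gives an x
   outside M such that lam [m, x] = m (lam x) lies in C, that is [m, x] lies in
   M, for all m in M. *)

(** * Linear algebra modulo a subspace *)

Section Subspaces.
Variables (K : fieldType) (V : lmodType K).
Implicit Types (S W X Y : set V) (n r : nat).

Definition subspace W :=
  W 0 /\ forall (a : K) u v, W u -> W v -> W (a *: u + v).

Lemma subspaceD W u v : subspace W -> W u -> W v -> W (u + v).
Proof. by move=> [_ WL] Wu Wv; rewrite -[u]scale1r; exact: WL. Qed.

Lemma subspaceZ W a u : subspace W -> W u -> W (a *: u).
Proof. by move=> [W0 WL] Wu; rewrite -[_ *: _]addr0; exact: WL. Qed.

Lemma subspaceN W u : subspace W -> W u -> W (- u).
Proof. by move=> WL Wu; rewrite -scaleN1r; exact: subspaceZ. Qed.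

Lemma subspaceB W u v : subspace W -> W u -> W v -> W (u - v).
Proof. by move=> WL Wu Wv; apply: subspaceD => //; exact: subspaceN. Qed.

Lemma subspace_addr W u v : subspace W -> W v -> W (u + v) -> W u.
Proof. by move=> WL Wv /(subspaceB WL)/(_ Wv); rewrite addrK. Qed.

Lemma subspace_scale_eq0 W a u : subspace W -> ~ W u -> W (a *: u) -> a = 0.
Proof.
move=> WL Wu Wau; apply: contrapT => /eqP a0; apply: Wu.
by rewrite -[u](scalerK a0); exact: subspaceZ.
Qed.

Lemma subspace_sum W n (F : 'I_n -> V) :
  subspace W -> (forall i, W (F i)) -> W (\sum_i F i).
Proof.
move=> WL WF; apply: big_ind => //; first by case: WL.
by move=> u v Wu Wv; exact: subspaceD.
Qed.

Lemma subspace0 : subspace [set 0].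
Proof. by split=> // a u v /= -> ->; rewrite scaler0 addr0. Qed.

Lemma lin_span_subspace S : subspace (lin_span S).
Proof.
split.
  by exists 0%N, (fun=> 0), (fun=> 0); split; [case|rewrite big_ord0].
move=> a _ _ [n [c [e [Se ->]]]] [m [c' [e' [Se' ->]]]].
exists (n + m)%N.
exists (fun i => match fintype.split i with inl i => a * c i | inr i => c' i end).
exists (fun i => match fintype.split i with inl i => e i | inr i => e' i end).
split; first by move=> i; case: (fintype.split i).
rewrite big_split_ord /= scaler_sumr; congr (_ + _); apply: eq_bigr => i _.
  by rewrite (unsplitK (inl i)) scalerA.
by rewrite (unsplitK (inr i)).
Qed.

Lemma sub_lin_span S : S `<=` lin_span S.
Proof.
move=> v Sv; exists 1%N, (fun=> 1), (fun=> v); split=> //.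
by rewrite big_ord1 scale1r.
Qed.

Lemma lin_span_min S W : subspace W -> S `<=` W -> lin_span S `<=` W.
Proof.
move=> WL SW _ [n [c [e [Se ->]]]]; apply: subspace_sum => // i.
by apply: subspaceZ => //; exact: SW.
Qed.

Lemma lin_span_rangeP n (e : 'I_n -> V) v :
  lin_span (range e) v -> exists c : 'I_n -> K, v = \sum_i c i *: e i.
Proof.
apply: (@lin_span_min (range e)
  [set v | exists c : 'I_n -> K, v = \sum_i c i *: e i]).
  split; first by exists (fun=> 0); rewrite big1 // => i _; rewrite scale0r.
  move=> a _ _ [c ->] [c' ->]; exists (fun i => a * c i + c' i).
  rewrite scaler_sumr -big_split /=; apply: eq_bigr => i _.
  by rewrite scalerA scalerDl.
move=> _ [i _ <-]; exists (fun j => (j == i)%:R).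
rewrite (bigD1 i) //= eqxx scale1r big1 ?addr0 // => j /negbTE ->.
by rewrite scale0r.
Qed.

(** [dep_mod Y r X] says that the image of the span of X modulo Y has dimension
   at most r.  Dependence of families, rather than a basis, is what the
   arguments below consume, and it passes to subsets for free. *)
Definition dep_mod Y r X := forall x : 'I_r.+1 -> V, (forall i, X (x i)) ->
  exists k : 'I_r.+1 -> K, (exists i, k i != 0) /\ Y (\sum_i k i *: x i).

Lemma dep_mod_sub Y Y' r X X' : Y `<=` Y' -> X' `<=` X ->
  dep_mod Y r X -> dep_mod Y' r X'.
Proof.
move=> YY' XX' dX x X'x; have [i|k [k0 Yk]] := dX x; first exact: XX'.
by exists k; split=> //; exact: YY'.
Qed.

Definition add_line W e : set V := [set v | exists k : K, W (v - k *: e)].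

Lemma add_line_subspace W e : subspace W -> subspace (add_line W e).
Proof.
move=> WL; split; first by exists 0; rewrite scale0r subr0; case: WL.
move=> a u v [k Wu] [k' Wv]; exists (a * k + k').
have -> : a *: u + v - (a * k + k') *: e = a *: (u - k *: e) + (v - k' *: e).
  by rewrite scalerDl scalerBr scalerA opprD addrACA.
by case: WL => _; apply.
Qed.

Lemma sub_add_line W e : subspace W -> W `<=` add_line W e.
Proof. by move=> WL v Wv; exists 0; rewrite scale0r subr0. Qed.

Lemma mem_add_line W e : subspace W -> add_line W e e.
Proof. by move=> [W0 _]; exists 1; rewrite scale1r subrr. Qed.

Lemma dep_cons Y r X e (x : 'I_r.+1 -> V) : dep_mod Y r.+1 X ->
  (forall i, X (x i)) -> X e -> exists (a : K) (k : 'I_r.+1 -> K),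
  [/\ Y (a *: e + \sum_i k i *: x i) & (exists i, k i != 0) \/ a != 0].
Proof.
move=> dX Xx Xe.
have [|k [[i ki] Yk]] := dX (fun i => oapp x e (unlift ord0 i)).
  by move=> i; case: (unlift _ i).
exists (k ord0), (fun j => k (lift ord0 j)); split.
  move: Yk; rewrite big_ord_recl unlift_none /=.
  by under eq_bigr do rewrite liftK /=.
case: (unliftP ord0 i) ki => [j -> kj|->]; first by left; exists j.
by right.
Qed.

Lemma dep_mod_add_line Y r X e : subspace Y -> X e -> ~ Y e ->
  dep_mod Y r.+1 X -> dep_mod (add_line Y e) r X.
Proof.
move=> YL Xe Ye dX x Xx; have [a [k [Yk k0]]] := dep_cons dX Xx Xe.
exists k; split; last first.
  by exists (- a); rewrite scaleNr opprK addrC.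
case: k0 => // /eqP a0; apply: contrapT => k0; apply: a0.
apply: (subspace_scale_eq0 YL Ye).
move: Yk; rewrite big1 ?addr0 // => i _.
apply/eqP; rewrite scaler_eq0; apply/orP; left; apply: contraT => ki.
by case: k0; exists i.
Qed.

(** The induction on the rank runs on this: cutting down to a K-subspace that
   misses an element of X lowers the dimension. *)
Lemma dep_mod_cut W r X e : subspace W -> X e -> ~ W e ->
  dep_mod [set 0] r.+1 X -> dep_mod [set 0] r (X `&` W).
Proof.
move=> WL Xe We dX x Xx.
have [i|a [k [Yk k0]]] := dep_cons dX (x := x) _ Xe; first by case: (Xx i).
have a0 : a = 0.
  have /eqP aE := Yk; rewrite /= addr_eq0 in aE.
  apply: (subspace_scale_eq0 WL We); rewrite (eqP aE).
  apply: subspaceN => //; apply: subspace_sum => // i.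
  by apply: subspaceZ => //; case: (Xx i).
rewrite a0 scale0r add0r eqxx in Yk k0.
by exists k; split=> //; case: k0.
Qed.

(** A largest independent family extracted from S spans S over K. *)
Lemma dep_basis n S : dep_mod [set 0] n S -> exists r (e : 'I_r -> V),
  [/\ (r <= n)%N, forall i, S (e i) & S `<=` lin_span (range e)].
Proof.
elim: n => [|n IH] dS.
  exists 0%N, (fun=> 0); split; [by []|by case|].
  move=> v Sv; have [i|k [[i]]] := dS (fun=> v); first exact: Sv.
  rewrite ord1 => /negbTE k0; rewrite /= big_ord1 => /eqP.
  rewrite scaler_eq0 k0 /=.
  by move=> /eqP ->; exact: (lin_span_subspace _).1.
have [/IH [r [e [rn Se spe]]]|] := pselect (dep_mod [set 0] n S).
  by exists r, e; split=> //; exact: leqW.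
move=> /existsNP[x /not_implyP[Sx xfree]].
exists n.+1, x; split=> // v Sv.
have [a [k [Yk k0]]] := dep_cons dS Sx Sv.
have spL := lin_span_subspace (range x).
have [a0|a0] := eqVneq a 0.
  rewrite a0 scale0r add0r eqxx in Yk k0.
  by case: xfree; exists k; split=> //; case: k0.
have /eqP aE := Yk; rewrite /= addr_eq0 in aE.
rewrite -[v](scalerK a0) (eqP aE); apply: subspaceZ => //.
apply: subspaceN => //; apply: subspace_sum => // i; apply: subspaceZ => //.
by apply: sub_lin_span; exists i.
Qed.

End Subspaces.

Lemma left_kernel_neq0 (K : fieldType) m n (C : 'M[K]_(m, n)) : (n < m)%N ->
  exists2 k : 'rV[K]_m, (exists i, k 0 i != 0) & k *m C = 0.
Proof.
move=> nm; have : kermx C != 0.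
  by rewrite -mxrank_eq0 mxrank_ker subn_eq0 -ltnNge
     (leq_ltn_trans (rank_leq_col C)).
case/rowV0Pn => k /sub_kermxP kC k0; exists k => //.
by case/rV0Pn: k0 => i ki; exists i.
Qed.

Lemma lin_span_dep (K : fieldType) (V : lmodType K) n (e : 'I_n -> V) :
  dep_mod [set 0] n (lin_span (range e)).
Proof.
move=> x xspan; have /choice[c xE] := fun i => lin_span_rangeP (xspan i).
have [k k0 kC] := left_kernel_neq0 (\matrix_(i, j) c i j) (ltnSn n).
exists (fun i => k 0 i); split=> //=.
under eq_bigr => i _ do rewrite xE scaler_sumr.
rewrite exchange_big /= big1 // => j _.
under eq_bigr => i _ do rewrite scalerA.
rewrite -scaler_suml; suff -> : \sum_i k 0 i * c i j = 0 by rewrite scale0r.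
have := congr1 (fun A : 'rV_n => A 0 j) kC; rewrite !mxE => kCj.
by rewrite -[RHS]kCj; apply: eq_bigr => i _; rewrite mxE.
Qed.

(** * Words of operators and common zeros *)

Section Killed.
Variables (I T : Type) (act : I -> T -> T).
Implicit Types (S : set I) (Y : set T) (N : nat).

Fixpoint killed Y S N (v : T) : Prop :=
  if N is N'.+1 then forall s, S s -> killed Y S N' (act s v) else Y v.

Lemma killed_leq Y S N N' v :
  (forall s, S s -> forall y, Y y -> Y (act s y)) ->
  (N <= N')%N -> killed Y S N v -> killed Y S N' v.
Proof.
move=> YS; elim: N N' v => [|N IH] [|N'] //= v NN' kv s Ss; last first.
  by apply: IH => //; exact: kv.
elim: N' v kv s Ss {NN'} => [|N' IH] v Yv s Ss /=; first exact: YS.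
by apply: IH; exact: YS.
Qed.

Lemma killed_sub Y Y' S N v : Y `<=` Y' -> killed Y S N v -> killed Y' S N v.
Proof.
move=> YY'; elim: N v => [|N IH] v /=; first exact: YY'.
by move=> kv s Ss; apply: IH; exact: kv.
Qed.

End Killed.

Lemma finite_bound (I : eqType) (S : set I) (Q : I -> nat -> Prop) :
  finite_set S -> (forall s m n, S s -> (m <= n)%N -> Q s m -> Q s n) ->
  (forall s, S s -> exists n, Q s n) -> exists n, forall s, S s -> Q s n.
Proof.
move=> /finite_seqP[l ->] {S}; elim: l => [|a l IH] Qmono Qex.
  by exists 0%N.
have [s m n sl|s sl|n Qn] := IH.
- by apply: Qmono; rewrite /= inE sl orbT.
- by apply: Qex; rewrite /= inE sl orbT.
have [|m Qm] := Qex a; first exact: mem_head.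
exists (maxn m n) => s /=; rewrite inE => /predU1P[->|sl].
  by apply: Qmono (leq_maxl _ _) Qm; exact: mem_head.
by apply: Qmono (leq_maxr _ _) (Qn _ sl); rewrite /= inE sl orbT.
Qed.

Section CommonZero.
Variables (K : fieldType) (V : lmodType K).
Variables (M : set (K -> K)) (act : (K -> K) -> V -> V) (X Y : set V).
Hypothesis YL : subspace Y.
Hypothesis actD : forall m u v, M m -> act m (u + v) = act m u + act m v.
Hypothesis actZ : forall m k v, M m -> act m (k *: v) = m k *: v + k *: act m v.
Hypothesis actY : forall m v, M m -> Y v -> Y (act m v).
Hypothesis actX : forall m v, M m -> X v -> X (act m v).

Let act0 m : M m -> act m 0 = 0.
Proof. by move=> /(actD 0 0)/eqP; rewrite addr0 -subr_eq subrr => /eqP. Qed.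

Let act_sum m n (k : nat -> K) (x : nat -> V) : M m ->
  act m (\sum_(i < n) k i *: x i) =
  \sum_(i < n) m (k i) *: x i + \sum_(i < n) k i *: act m (x i).
Proof.
move=> Mm; elim: n => [|n IH]; first by rewrite !big_ord0 act0 ?addr0.
by rewrite !big_ord_recr /= actD // actZ // IH addrACA.
Qed.

Variable B : set (K -> K).
Hypothesis Bfin : finite_set B.
Hypothesis BM : B `<=` M.
Hypothesis Bconst :
  forall k, (forall b, B b -> b k = 0) -> forall m, M m -> m k = 0.
Hypothesis jnil : forall S, finite_set S -> S `<=` M ->
  forall x, X x -> exists N, killed act Y S N x.

(** A finite part of M has a common zero: follow a word of operators out of Y
   for as long as possible. *)
Let finite_zero S : finite_set S -> S `<=` M -> (exists2 x, X x & ~ Y x) ->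
  exists x, [/\ X x, ~ Y x & forall s, S s -> Y (act s x)].
Proof.
move=> Sfin SM [x Xx Yx]; have [N] := jnil Sfin SM Xx.
elim: N x Xx Yx => [|N IH] //= x Xx Yx kx.
have [xz|/existsNP[s /not_implyP[Ss Ysx]]] :=
  pselect (forall s, S s -> Y (act s x)); first by exists x.
by apply: (IH (act s x)) => //; [apply: actX => //; exact: SM|exact: kx].
Qed.

(** Most recent pair first.  The operator recorded with a vector witnesses that
   the vector is not a common zero, and is imposed on all the later ones. *)
Let Fixpoint obstructed (s : seq (V * (K -> K))) : Prop :=
  if s is (x, m) :: s' then
    [/\ X x, M m, ~ Y (act m x),
       forall b, B b -> Y (act b x) & forall p, p \in s' -> Y (act p.2 x)]
    /\ obstructed s'
  else True.

Let obstructed_op s p : obstructed s -> p \in s -> M p.2.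
Proof.
elim: s => [|[x m] s IH] //= [[_ Mm _ _ _] obs].
by rewrite inE => /predU1P[->//|]; exact: IH.
Qed.

Let vec (s : seq (V * (K -> K))) i := nth 0 (unzip1 s) i.

(** For coefficients that are constants, applying the operator recorded with
   the oldest vector isolates the coefficient of that vector, since it sends
   all the later ones into Y. *)
Let obstructed_const s (k : nat -> K) y : obstructed s ->
  (forall p, p \in s -> Y (act p.2 y)) ->
  (forall i, (i < size s)%N -> forall m, M m -> m (k i) = 0) ->
  Y (\sum_(i < size s) k i *: vec s i + y) ->
  forall i, (i < size s)%N -> k i = 0.
Proof.
elim: s k y => [|[x m] s IH] k y //= [[Xx Mm Ymx _ sx] obs] sy kc.
rewrite big_ord_recl /= addrAC addrC => Yk.
have ks i : (i < size s)%N -> k i.+1 = 0.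
  apply: (IH (k \o succn) (k 0%N *: x + y)) => //.
  - move=> p ps.
    have Mp := obstructed_op obs ps.
    rewrite actD // actZ // kc // scale0r add0r.
    apply: subspaceD => //; first by apply: subspaceZ => //; exact: sx.
    by apply: sy; rewrite inE ps orbT.
  - by move=> j js; exact: (kc j.+1).
have k0 : k 0%N = 0.
  apply: (subspace_scale_eq0 YL Ymx).
  move: Yk; rewrite big1 => [|j _]; last by rewrite ks // scale0r.
  rewrite add0r => /(actY Mm); rewrite actD // actZ // kc // scale0r add0r.
  apply: subspace_addr => //.
  exact: (sy (x, m)  (mem_head _ _)).
by case.
Qed.

(** As for the independence of constants: once the leading coefficient is
   normalised to 1, applying B yields a shorter relation, so that all
   coefficients are constants and [obstructed_const] applies. *)
Let obstructed_free s (k : nat -> K) : obstructed s ->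
  Y (\sum_(i < size s) k i *: vec s i) -> forall i, (i < size s)%N -> k i = 0.
Proof.
elim: s k => [|[x m] s IH] k //= [[Xx Mm Ymx Bx sx] obs].
rewrite big_ord_recl /= => Yk.
have [k0|k0] := eqVneq (k 0%N) 0.
  rewrite k0 scale0r add0r in Yk.
  by case=> // i; exact: (IH (k \o succn) obs Yk).
(* normalise the coefficient of the most recent vector to 1 *)
pose k' i := (k 0%N)^-1 * k i.+1.
have Yk' : Y (\sum_(i < size s) k' i *: vec s i + x).
  have := subspaceZ (k 0%N)^-1 YL Yk.
  rewrite scalerDr scalerK // addrC scaler_sumr.
  by under eq_bigr do rewrite scalerA.
have BY i b : (i < size s)%N -> B b -> Y (act b (vec s i)).
  move=> + Bb; elim: s i obs {IH sx Yk Yk'} => [|[x' m'] s IH] //= i.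
  move=> [[_ _ _ Bx' _] obs].
  by case: i => [|i] /=; [move=> _; exact: Bx'|exact: IH].
have k'c i : (i < size s)%N -> forall m, M m -> m (k' i) = 0.
  move=> i_s; apply: Bconst => b Bb; apply: (IH (b \o k')) i_s => //.
  have Mb := BM Bb; have := actY Mb Yk'; rewrite actD // act_sum //.
  move=> /(subspace_addr YL (Bx _ Bb)); apply: (subspace_addr YL).
  by apply: subspace_sum => // j; apply: subspaceZ => //; exact: BY.
have k'0 := obstructed_const obs sx k'c Yk'.
case: Ymx; apply: actY => //; move: Yk'.
by rewrite big1 ?add0r // => i _; rewrite k'0 // scale0r.
Qed.

Variable r : nat.
Hypothesis Xdep : dep_mod Y r X.

(** Otherwise one builds an obstructed list of length r + 1, and such lists are
   independent modulo Y. *)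
Lemma common_zero : (exists2 x, X x & ~ Y x) ->
  exists x, [/\ X x, ~ Y x & forall m, M m -> Y (act m x)].
Proof.
move=> XY; apply: contrapT => nozero.
have [s [obs szs]] : exists s, obstructed s /\ size s = r.+1.
  elim: (r.+1) => [|j [s [obs szs]]]; first by exists [::].
  have [||x [Xx Yx Sx]] := @finite_zero (B `|` [set p.2 | p in [set` s]]) _ _ XY.
  - by rewrite finite_setU; split=> //; apply: finite_image; exact: finite_seq.
  - by move=> m [/BM//|[p /= ps <-]]; exact: obstructed_op ps.
  have [m Mm Ymx] : exists2 m, M m & ~ Y (act m x).
    apply: contrapT => nm; apply: nozero; exists x; split=> // m Mm.
    by apply: contrapT => Ymx; apply: nm; exists m.
  exists ((x, m) :: s); split; last by rewrite /= szs.
  split=> //; split=> // [b Bb|p ps]; apply: Sx; first by left.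
  by right; exists p.
have [|k [[i ki] Yk]] := Xdep (x := fun i : 'I_r.+1 => vec s i).
  move=> i; have : (i < size s)%N by rewrite szs.
  elim: s (i : nat) obs {szs} => [|[x m] s IH] //= [|j] [[Xx _ _ _ _] obs] //.
  exact: IH.
case/eqP: ki; rewrite -[i]inord_val.
apply: (@obstructed_free s (fun j => k (inord j))) => //; rewrite szs //.
by under eq_bigr do rewrite inord_val.
Qed.

End CommonZero.

(** * Additive maps and brackets *)

Section AdditiveMaps.
Variable V : zmodType.
Implicit Types (f g h : V -> V) (X Y L : set (V -> V)).

Lemma zmod_morph0 f : zmod_morphism f -> f 0 = 0.
Proof. by move=> fB; have := fB 0 0; rewrite !subrr. Qed.

Lemma zmod_morphN f x : zmod_morphism f -> f (- x) = - f x.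
Proof. by move=> fB; rewrite -[- x]sub0r fB zmod_morph0 // sub0r. Qed.

Lemma zmod_morphD f x y : zmod_morphism f -> f (x + y) = f x + f y.
Proof. by move=> fB; rewrite -{1}[y]opprK fB (zmod_morphN _ fB) opprK. Qed.

Lemma bracketC f g : bracket f g = - bracket g f.
Proof. by rewrite /bracket opprB. Qed.

Lemma bracketxx f : bracket f f = 0.
Proof. by rewrite /bracket subrr. Qed.

Lemma bracketBl f g h : zmod_morphism h ->
  bracket (f - g) h = bracket f h - bracket g h.
Proof.
move=> hB; apply/funext => v; rewrite /bracket !fctE /= hB.
by rewrite !opprB addrACA [RHS]addrACA; congr (_ + _); rewrite addrC.
Qed.

Lemma bracketBr f g h : zmod_morphism f ->
  bracket f (g - h) = bracket f g - bracket f h.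
Proof.
move=> fB; rewrite bracketC bracketBl // opprB.
by rewrite (bracketC f g) (bracketC f h) opprK addrC.
Qed.

Lemma bracket0l f : zmod_morphism f -> bracket 0 f = 0.
Proof.
by move=> fB; rewrite -[X in bracket X _](subrr 0) bracketBl // subrr.
Qed.

Lemma bracket0r f : zmod_morphism f -> bracket f 0 = 0.
Proof. by move=> fB; rewrite bracketC bracket0l // oppr0. Qed.

Lemma bracket_jacobi f g h :
    zmod_morphism f -> zmod_morphism g -> zmod_morphism h ->
  bracket f (bracket g h) = bracket (bracket f g) h + bracket g (bracket f h).
Proof.
move=> fB gB hB; apply/funext => v; rewrite /bracket !fctE /= !fB !gB !hB.
set a := f (g (h v)); set b := f (h (g v)); set c := g (h (f v)).
set d := h (g (f v)); set a' := g (f (h v)); set b' := h (f (g v)).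
rewrite !opprB.
rewrite [RHS]addrACA !subrKA [LHS]addrACA [RHS]addrACA.
by congr (_ + _); rewrite addrC.
Qed.

Lemma subgroupN X f : additive_subgroup X -> X f -> X (- f).
Proof. by move=> [X0 XB] Xf; rewrite -sub0r; exact: XB. Qed.

Lemma subgroup0 : additive_subgroup [set 0 : V -> V].
Proof. by split=> // f g -> ->; exact: subrr. Qed.

Definition additive_span X := smallest (@additive_subgroup V) X.

Lemma additive_span_subgroup X : additive_subgroup (additive_span X).
Proof.
split=> [Y [[Y0 _] _]|f g Xf Xg Y YX] //.
by apply: YX.1.2; [exact: Xf|exact: Xg].
Qed.

Lemma sub_additive_span X : X `<=` additive_span X.
Proof. exact: sub_gen_smallest. Qed.

Lemma additive_span_min X Y :
  additive_subgroup Y -> X `<=` Y -> additive_span X `<=` Y.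
Proof. exact: smallest_sub. Qed.

Lemma additive_span_sub X Y : X `<=` Y -> additive_span X `<=` additive_span Y.
Proof.
move=> XY; apply: additive_span_min; first exact: additive_span_subgroup.
by move=> f /XY; exact: sub_additive_span.
Qed.

Lemma additive_maps_subgroup : additive_subgroup (@zmod_morphism V V).
Proof.
split=> [x y|f g fB gB x y]; first by rewrite [RHS]subr0.
by rewrite !fctE fB gB !opprB addrACA [RHS]addrACA [X in _ + X]addrC.
Qed.

(** The bracket is biadditive only on additive maps, whence the first
   hypothesis. *)
Lemma span_lie_ring X : X `<=` @zmod_morphism V V ->
  (forall f g, X f -> X g -> additive_span X (bracket f g)) ->
  lie_ring (additive_span X).
Proof.
move=> Xadd XX; have XL := additive_span_subgroup X.
have spadd := additive_span_min additive_maps_subgroup Xadd.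
split=> // f g Xf; move: g.
suff : additive_span X `<=`
    [set g | zmod_morphism g /\ additive_span X (bracket f g)].
  by move=> Xsub g /Xsub[].
have fB := spadd _ Xf; apply: additive_span_min.
  split.
    split; first exact: additive_maps_subgroup.1.
    by rewrite bracket0r //; exact: XL.1.
  move=> g h [gB Xg] [hB Xh]; split; first exact: additive_maps_subgroup.2.
  by rewrite bracketBr //; exact: XL.2.
move=> g Xg; have gB := Xadd _ Xg; split=> //.
move: f Xf {fB}; apply: additive_span_min; last by move=> f Xf; exact: XX.
split=> /=; first by rewrite bracket0l //; exact: XL.1.
by move=> f h Xf Xh; rewrite bracketBl //; exact: XL.2.
Qed.

End AdditiveMaps.

(** * Jointly nilpotent subrings of Engel rings *)

Section EngelRing.
Variables (V : zmodType) (L0 : set (V -> V)).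
Implicit Types (S T M U I L : set (V -> V)) (d f v : V -> V) (N : nat).

Definition Engel_ring := [/\ L0 `<=` @zmod_morphism V V, lie_ring L0 &
  forall d f, L0 d -> L0 f -> exists N, iter N (bracket d) f = 0].

Definition ad_killed := killed (@bracket V) [set 0].

(** Local nilpotency of M is recorded through its action on the whole of L0, and
   not on M alone: this is what makes the property stable under adding a
   normalising element, and what [common_zero] asks for. *)
Definition jointly_nilpotent M :=
  forall S, finite_set S -> S `<=` M ->
  forall f, L0 f -> exists N, ad_killed S N f.

Hypothesis L0_Engel : Engel_ring.

Let L0_add : L0 `<=` @zmod_morphism V V. Proof. by case: L0_Engel. Qed.
Let L0_sub : additive_subgroup L0. Proof. by case: L0_Engel => _ []. Qed.
Let L0_lie f g : L0 f -> L0 g -> L0 (bracket f g).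
Proof. by case: L0_Engel => _ [_ +] _; apply. Qed.

Lemma ad_killed_leq S N N' f : S `<=` L0 -> (N <= N')%N ->
  ad_killed S N f -> ad_killed S N' f.
Proof.
by move=> SL; apply: killed_leq => s /SL/L0_add sB _ ->; exact: bracket0r.
Qed.

Lemma ad_killed_sub S T N f : S `<=` T -> ad_killed T N f -> ad_killed S N f.
Proof.
by move=> ST; elim: N f => [|N IH] //= f Tf s /ST Ts; apply: IH; exact: Tf.
Qed.

Lemma ad_killed_subgroup S N : S `<=` L0 -> additive_subgroup (ad_killed S N).
Proof.
move=> SL; elim: N => [|N [IH0 IHB]]; first exact: subgroup0.
split=> [s Ss|f g Sf Sg s Ss] /=; first by rewrite bracket0r //; exact/L0_add/SL.
by rewrite bracketBr; [apply: IHB; [exact: Sf|exact: Sg]|exact/L0_add/SL].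
Qed.

(** A bound on words in S is a bound on words in the additive span of S, since
   such a word expands into a sum of words in S. *)
Lemma ad_killed_span S N f : S `<=` L0 -> L0 f ->
  ad_killed S N f -> ad_killed (additive_span S) N f.
Proof.
move=> SL; elim: N f => [|N IH] //= f Lf Sf.
suff : additive_span S `<=` [set s | ad_killed S N (bracket s f)].
  move=> sub s Ss; apply: IH; last exact: sub.
  by apply: L0_lie => //; apply: (additive_span_min L0_sub SL).
apply: additive_span_min => //; have [N0 NB] := ad_killed_subgroup N SL.
split=> [|s t Ns Nt] /=; first by rewrite bracket0l //; exact: L0_add.
by rewrite bracketBl; [exact: NB|exact: L0_add].
Qed.

Lemma finite_span_support M S : finite_set S -> S `<=` additive_span M ->
  exists T, [/\ finite_set T, T `<=` M & S `<=` additive_span T].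
Proof.
have one s : additive_span M s ->
    exists T, [/\ finite_set T, T `<=` M & additive_span T s].
  apply: (@additive_span_min _ _
    [set s | exists T, [/\ finite_set T, T `<=` M & additive_span T s]]).
    split.
      by exists set0; split=> //; exact: (additive_span_subgroup _).1.
    move=> f g [T [Tf TM sT]] [T' [T'f T'M sT']]; exists (T `|` T'); split.
    - by rewrite finite_setU.
    - by move=> h [/TM|/T'M].
    - apply: (additive_span_subgroup _).2.
        by apply: additive_span_sub sT => h; left.
      by apply: additive_span_sub sT' => h; right.
  move=> t Mt; exists [set t]; split; first exact: finite_set1.
    by move=> _ ->.
  exact: sub_additive_span.
move=> /finite_seqP[l ->] {S}; elim: l => [|a l IH] SM.
  by exists set0; split.
have [|T [Tf TM lT]] := IH.
  by move=> s sl; apply: SM; rewrite /= inE [_ \in _]sl orbT.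
have [|T' [T'f T'M aT']] := one a; first by apply: SM; exact: mem_head.
exists (T `|` T'); split.
- by rewrite finite_setU.
- by move=> h [/TM|/T'M].
- move=> s /=; rewrite inE => /predU1P[->|sl].
    by apply: additive_span_sub aT' => h; right.
  by apply: additive_span_sub (lT s sl) => h; left.
Qed.

Lemma jointly_nilpotent_span M : M `<=` L0 ->
  jointly_nilpotent M -> jointly_nilpotent (additive_span M).
Proof.
move=> ML nM S Sf /(finite_span_support Sf)[T [Tf TM ST]] f Lf.
have [N Nf] := nM T Tf TM f Lf; exists N; apply: (ad_killed_sub ST).
by apply: ad_killed_span => // t /TM/ML.
Qed.

Lemma jointly_nilpotent0 : jointly_nilpotent [set 0].
Proof.
move=> S _ S0 f Lf; exists 1%N => s /S0 ->.
by rewrite /= bracket0l //; exact: L0_add.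
Qed.

(** The iterates of ad x at each of finitely many elements end at 0. *)
Lemma finite_saturation x S : L0 x -> finite_set S -> S `<=` L0 ->
  finite_set [set iter k (bracket x) s | k in setT & s in S].
Proof.
move=> Lx Sf SL; case: L0_Engel => _ _ Eng.
have [N NS] : exists N, forall s, S s -> iter N (bracket x) s = 0.
  apply: finite_bound => // [s m n _ mn m0|s /SL]; last exact: Eng.
  rewrite -(subnK mn) iterD m0; elim: (n - m)%N => //= j ->.
  by rewrite bracket0r //; exact: L0_add.
apply: (@sub_finite_set _ _
    ([set iter k (bracket x) s | k in `I_N & s in S] `|` [set 0])).
  move=> _ [k _ [s Ss <-]]; have [kN|Nk] := ltnP k N.
    by left; exists k => //; exists s.
  right; rewrite -(subnK Nk) iterD NS //; elim: (k - N)%N => //= j ->.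
  by rewrite bracket0r //; exact: L0_add.
rewrite finite_setU; split; last exact: finite_set1.
by apply: finite_image2 => //; exact: finite_II.
Qed.

(** Let T be a finite subset of M stable under ad x.  The vectors killed by all
   T-words of length j form an ad x-stable set.  A word in T and x applied to
   such a vector v begins either with many letters x, which kill v, or with a
   few letters x followed by a letter of T, which leads to one of finitely many
   vectors killed by T-words of length j - 1. *)
Lemma jointly_nilpotent_extend M x : M `<=` L0 -> L0 x ->
  (forall f, M f -> M (bracket x f)) ->
  jointly_nilpotent M -> jointly_nilpotent (M `|` [set x]).
Proof.
move=> ML Lx xM nM S Sf SM f Lf; case: L0_Engel => _ _ Eng.
pose T := [set iter k (bracket x) s | k in setT & s in S `&` M].
have Tf : finite_set T.
  apply: finite_saturation => // [|s [_ /ML]//].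
  by apply: sub_finite_set Sf => s [].
have TM : T `<=` M.
  by move=> _ [k _ [s [_ Ms] <-]]; elim: k => //= k; exact: xM.
have TL : T `<=` L0 by move=> t /TM/ML.
have xT t : T t -> T (bracket x t).
  by move=> [k _ [s Ss <-]]; exists k.+1 => //; exists s.
have SxT : S `<=` T `|` [set x].
  move=> s Ss; case: (SM s Ss) => [Ms|->]; last by right.
  by left; exists 0%N => //; exists s.
have TxL : T `|` [set x] `<=` L0 by move=> t [/TL//|->].
have killx j v : L0 v -> ad_killed T j v -> ad_killed T j (bracket x v).
  elim: j v => [|j IH] v Lv /=.
    by move=> ->; rewrite bracket0r //; exact: L0_add.
  move=> Tv t Tt; have Lt := TL t Tt.
  have -> : bracket t (bracket x v) =
      bracket x (bracket t v) - bracket (bracket x t) v.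
    have [xB tB vB] := And3 (L0_add Lx) (L0_add Lt) (L0_add Lv).
    by rewrite (bracket_jacobi xB tB vB) addrAC subrr add0r.
  apply: (ad_killed_subgroup _ TL).2.
    by apply: IH; [exact: L0_lie|exact: Tv].
  by apply: Tv; exact: xT.
have main j v : L0 v -> ad_killed T j v ->
    exists N, ad_killed (T `|` [set x]) N v.
  elim: j v => [|j IH] v Lv; first by exists 0%N.
  have [n nv] := Eng x v Lx Lv.
  elim: n v Lv nv => [|n IHn] v Lv; first by move=> /= ->; exists 0%N.
  rewrite iterSr => nv Tv.
  have [N1 N1x] := IHn _ (L0_lie Lx Lv) nv (killx _ _ Lv Tv).
  have [N2 N2T] : exists N, forall t, T t ->
      ad_killed (T `|` [set x]) N (bracket t v).
    apply: finite_bound => // [t m p _ mp|t Tt]; first exact: ad_killed_leq.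
    by apply: IH; [apply: L0_lie => //; exact: TL|exact: Tv].
  exists (maxn N1 N2).+1 => t [Tt|->].
    by apply: ad_killed_leq (leq_maxr _ _) (N2T _ Tt).
  by apply: ad_killed_leq (leq_maxl _ _) N1x.
have [j Tj] := nM T Tf TM f Lf; have [N NT] := main j f Lf Tj.
by exists N; exact: ad_killed_sub NT.
Qed.

Lemma lie_ring_extend M x : lie_ring M -> M `<=` L0 -> L0 x ->
  (forall f, M f -> M (bracket x f)) ->
  lie_ring (additive_span (M `|` [set x])).
Proof.
move=> [Msub Mlie] ML Lx xM; apply: span_lie_ring.
  by move=> f [/ML/L0_add//|->]; exact: L0_add.
move=> f g [Mf|->] [Mg|->].
- by apply: sub_additive_span; left; exact: Mlie.
- rewrite bracketC; apply: sub_additive_span; left; apply: subgroupN => //.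
  exact: xM.
- by apply: sub_additive_span; left; exact: xM.
- by rewrite bracketxx; exact: (additive_span_subgroup _).1.
Qed.

(** Every additive group between I and U is an ideal of U, so the elements of a
   finite subset of U can be added to I one at a time. *)
Lemma jointly_nilpotent_ideal I U : lie_ring U -> U `<=` L0 ->
  lie_ring I -> I `<=` U -> (forall f g, U f -> U g -> I (bracket f g)) ->
  jointly_nilpotent I -> jointly_nilpotent U.
Proof.
move=> UL UL0 IL IU UU nI S /finite_seqP[l ->{S}] lU.
have [M [_ _ _ nM lM]] : exists M, [/\ lie_ring M, I `<=` M, M `<=` U,
    jointly_nilpotent M & [set` l] `<=` M].
  elim: l lU => [|x l IH] lU; first by exists I; split.
  have [|M [ML IM MU nM lM]] := IH.
    by move=> s sl; apply: lU; rewrite /= inE [_ \in _]sl orbT.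
  have Ux : U x by apply: lU; exact: mem_head.
  have ML0 : M `<=` L0 by move=> f /MU/UL0.
  have xM f : M f -> M (bracket x f) by move=> /MU Uf; apply: IM; exact: UU.
  have MsubX : M `|` [set x] `<=` additive_span (M `|` [set x]).
    exact: sub_additive_span.
  exists (additive_span (M `|` [set x])); split.
  - by apply: lie_ring_extend => //; exact: UL0.
  - by move=> f /IM Mf; apply: MsubX; left.
  - by apply: additive_span_min; [case: UL|move=> f [/MU//|->]].
  - apply: jointly_nilpotent_span; first by move=> f [/ML0//|->]; exact: UL0.
    by apply: jointly_nilpotent_extend => //; exact: UL0.
  - move=> s /=; rewrite inE => /predU1P[->|sl]; first by apply: MsubX; right.
    by apply: MsubX; left; exact: lM.
by apply: nM; first exact: finite_seq.
Qed.

(** By Zorn's lemma; the last property is maximality among the rings M + Zx. *)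
Lemma maximal_jointly_nilpotent L : lie_ring L -> L `<=` L0 -> exists M,
  [/\ lie_ring M, M `<=` L, jointly_nilpotent M,
    forall U, lie_ring U -> U `<=` L -> M `<=` U -> jointly_nilpotent U ->
      U `<=` M &
    forall x, L x -> (forall f, M f -> M (bracket x f)) -> M x].
Proof.
move=> LL LL0.
pose P M := [/\ lie_ring M, M `<=` L & jointly_nilpotent M].
(* the empty set is admitted so that the union of an empty chain is *)
have [F FP Ftot|M [PM Mmax]] := @Zorn_bigcup _ [set M | M = set0 \/ P M].
  have [[M0 [FM0 M0P]]|Fempty] := pselect (exists M, F M /\ P M); last first.
    left; apply/seteqP; split=> // f [M FM Mf].
    case: (FP M FM) => [M0|PM]; first by rewrite M0 in Mf.
    by case: Fempty; exists M.
  have chain M f g : F M -> M f -> (\bigcup_(M in F) M) g ->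
      exists U, [/\ F U, P U, U f & U g].
    move=> FM Mf [U FU Ng].
    have [MN|NM] := Ftot _ _ FM FU.
      exists U; split=> //; last exact: MN.
      by case: (FP U FU) => // U0; rewrite U0 in Ng.
    exists M; split=> //; last exact: NM.
    by case: (FP M FM) => // M0'; rewrite M0' in Mf.
  right; split; [split; [split|]|..].
  - by exists M0 => //; case: M0P => [[[]]].
  - move=> f g [M FM Mf] /(chain M f g FM Mf)[U [FU [[[_ NB] _] _ _] Nf Ng]].
    by exists U => //; exact: NB.
  - move=> f g [M FM Mf] /(chain M f g FM Mf)[U [FU [[_ NB] _ _] Nf Ng]].
    by exists U => //; exact: NB.
  - move=> f [M FM Mf]; case: (FP M FM) => [M0'|[_ ML _]]; last exact: ML.
    by rewrite M0' in Mf.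
  - move=> S Sf SF.
    suff [U [FU [_ _ nN] SN]] : exists U, [/\ F U, P U & S `<=` U] by exact: nN.
    move: Sf SF => /finite_seqP[l ->{S}]; elim: l => [|x l IH] lF.
      by exists M0; split.
    have [|U [FU PU lN]] := IH.
      by move=> s sl; apply: lF; rewrite /= inE [_ \in _]sl orbT.
    have [|U' FU' U'x] := lF x; first exact: mem_head.
    have [UU'|U'U] := Ftot _ _ FU FU'.
      exists U'; split=> //.
        by case: (FP U' FU') => // U0; rewrite U0 in U'x.
      by move=> s /=; rewrite inE => /predU1P[->//|sl]; exact/UU'/lN.
    exists U; split=> // s /=; rewrite inE => /predU1P[->|sl]; last exact: lN.
    exact: U'U.
have {}Mmax U : P U -> M `<=` U -> U `<=` M.
  move=> PU MU; apply: contrapT => UM; apply: (Mmax U); last by right.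
  by split.
have [ML ML' nM] : P M.
  case: PM => // M0.
  suff : [set 0] `<=` M by rewrite M0 => /(_ 0); case.
  apply: Mmax; last by rewrite M0.
  split; last exact: jointly_nilpotent0.
    split; first exact: subgroup0.
    by move=> f g -> ->; exact: bracketxx.
  by move=> f ->; exact: LL.1.1.
exists M; split=> // [U UL UL' MU nU|x Lx xM]; first by apply: Mmax.
have ML0 : M `<=` L0 by move=> f /ML'/LL0.
apply: (Mmax (additive_span (M `|` [set x]))).
- split.
  + by apply: lie_ring_extend => //; exact: LL0.
  + by apply: additive_span_min; [case: LL|move=> f [/ML'//|->]].
  + apply: jointly_nilpotent_span; first by move=> f [/ML0//|->]; exact: LL0.
    by apply: jointly_nilpotent_extend => //; exact: LL0.
- by move=> f Mf; apply: sub_additive_span; left.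
- by apply: sub_additive_span; right.
Qed.

Section Nilpotent.
Variable S : set (V -> V).

(** Right-normed commutators, indexed by their number of brackets. *)
Inductive word_in : nat -> (V -> V) -> Prop :=
| word_letter s : S s -> word_in 0 s
| word_cons j s f : S s -> word_in j f -> word_in j.+1 (bracket s f).

Definition word_filtration j :=
  additive_span [set f | exists2 i, (j <= i)%N & word_in i f].

Hypothesis SL : S `<=` L0.

Let word_L0 i f : word_in i f -> L0 f.
Proof.
by elim=> [s /SL//|j s g /SL Ls _ Lg]; exact: L0_lie.
Qed.

Let filt_sub i : additive_subgroup (word_filtration i).
Proof. exact: additive_span_subgroup. Qed.

Let filt_L0 i f : word_filtration i f -> L0 f.
Proof. by apply: additive_span_min => // g [j _]; exact: word_L0. Qed.

Let filt_letter s j f : S s -> word_filtration j f ->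
  word_filtration j.+1 (bracket s f).
Proof.
move=> Ss; have sB := L0_add (SL Ss).
apply: (@additive_span_min _ _ [set f | word_filtration j.+1 (bracket s f)]).
  split=> [|g h sg sh] /=; first by rewrite bracket0r //; exact: (filt_sub _).1.
  by rewrite bracketBr //; exact: (filt_sub _).2.
move=> g [i ji wg]; apply: sub_additive_span; exists i.+1 => //.
exact: word_cons.
Qed.

Let filt_word i j w f : word_in i w -> word_filtration j f ->
  word_filtration (i + j).+1 (bracket w f).
Proof.
move=> ww; elim: ww j f => [s Ss|k s w' Ss ww' IH] j f Ff.
  exact: filt_letter.
have [Ls Lw Lf] := And3 (SL Ss) (word_L0 ww') (filt_L0 Ff).
have -> : bracket (bracket s w') f =
    bracket s (bracket w' f) - bracket w' (bracket s f).
  have [sB wB fB] := And3 (L0_add Ls) (L0_add Lw) (L0_add Lf).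
  by rewrite (bracket_jacobi sB wB fB) addrK.
apply: (filt_sub _).2.
  by rewrite addSn; apply: filt_letter => //; exact: IH.
by rewrite addSnnS; apply: IH; exact: filt_letter.
Qed.

(** Right-normed commutators suffice: by the Jacobi identity, bracketing with
   [s, w] amounts to bracketing with s and w in the two possible orders. *)
Lemma word_filtration_bracket i j f g :
  word_filtration i f -> word_filtration j g ->
  word_filtration (i + j).+1 (bracket f g).
Proof.
move=> + Fg; have gB := L0_add (filt_L0 Fg).
apply: (@additive_span_min _ _
  [set f | word_filtration (i + j).+1 (bracket f g)]).
  split=> [|h k sh sk] /=; first by rewrite bracket0l //; exact: (filt_sub _).1.
  by rewrite bracketBl //; exact: (filt_sub _).2.
move=> w [k ik ww] /=; have := filt_word ww Fg.
apply: additive_span_sub => h [l kl wh]; exists l => //.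
by apply: leq_trans kl; rewrite ltnS leq_add2r.
Qed.

Lemma word_filtration_antimono i j : (i <= j)%N ->
  word_filtration j `<=` word_filtration i.
Proof.
move=> ij; apply: additive_span_sub => f [k jk wf].
by exists k => //; exact: leq_trans jk.
Qed.

(** Long right-normed commutators of generators vanish, as they are words of
   generators applied to a generator, and the lower central series is
   contained in the filtration by commutator length. *)
Lemma jointly_nilpotent_lie_gen : finite_set S ->
  jointly_nilpotent S -> nilpotent_lie_ring (lie_gen S).
Proof.
move=> Sf nS.
have [N NS] : exists N, forall s, S s -> ad_killed S N s.
  apply: finite_bound => // [s m n _|s Ss]; first exact: ad_killed_leq.
  by apply: nS => //; exact: SL.
have word_killed i f : word_in i f -> ad_killed S (N - i) f.
  elim=> [s /NS|j s g Ss _]; first by rewrite subn0.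
  rewrite subnS; case: (N - j)%N => [|k] /=; last exact.
  by move=> ->; apply: bracket0r; exact/L0_add/SL.
have genF : lie_gen S `<=` word_filtration 0.
  apply: smallest_sub; last first.
    move=> s Ss; apply: sub_additive_span.
    by exists 0%N => //; exact: word_letter.
  split=> // f g Ff Fg.
  apply: word_filtration_antimono (word_filtration_bracket Ff Fg).
  exact: leq0n.
have lcF n : lower_central (lie_gen S) n `<=` word_filtration n.
  elim: n => [|n IH] //=; apply: additive_span_min => //.
  move=> _ [f Lf [g /genF Lg <-]]; rewrite -[n.+1]addn0 addSn.
  by apply: word_filtration_bracket => //; exact: IH.
exists N; apply/seteqP; split.
  move=> f /lcF; apply: additive_span_min; first exact: subgroup0.
  by move=> g [i Ni /word_killed]; rewrite (eqP (_ : N - i == 0)%N) // subn_eq0.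
move=> _ ->; case: (N) => [|n] /=; last exact: (additive_span_subgroup _).1.
by move=> Y [[[Y0 _] _] _].
Qed.

End Nilpotent.

End EngelRing.

(** * Derivations of a field *)

Section DerivationSpace.
Variable K : fieldType.
Local Notation V := (K -> K^o).
Implicit Types (f g u v : V) (X W : set V) (a c : K).

Lemma Der_additive f : Der K f -> zmod_morphism f.
Proof. by case. Qed.

Lemma Der_subspace : subspace (Der K : set V).
Proof.
split; first by case: (lie_ring_Der K) => [[]].
move=> a u v [uB uM] [vB vM]; split=> x y.
  by rewrite !fctE uB vB scalerBr opprD addrACA.
rewrite !fctE uM vM; rewrite /GRing.scale /=; ring.
Qed.

Lemma bracketDr f u v : zmod_morphism f ->
  bracket f (u + v) = (bracket f u : V) + bracket f v.
Proof.
move=> fB; rewrite -{1}[v]opprK bracketBr // -[- v]sub0r bracketBr //.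
by rewrite bracket0r // sub0r opprK.
Qed.

Lemma bracketZr f a u : Der K f ->
  bracket f (a *: u) = f a *: u + a *: (bracket f u : V).
Proof.
move=> [fB fM]; apply/funext => x; rewrite /bracket !fctE /= /GRing.scale /= fM.
ring.
Qed.

Lemma subspace_bracketC W f g :
  subspace W -> W (bracket f g) -> W (bracket g f).
Proof.
move=> WL Wfg; have -> : bracket g f = - (bracket f g : V) by rewrite bracketC.
exact: subspaceN.
Qed.

(** Stability has to be checked only on generators, because
   [f, a g] = f(a) g + a [f, g]; the term f(a) g forces W to contain X. *)
Lemma bracket_span f X W : Der K f -> subspace W -> X `<=` W ->
  (forall g, X g -> W (bracket f g)) ->
  forall g, lin_span X g -> W (bracket f g).
Proof.
move=> fD WL XW fX.
suff sub : lin_span X `<=` [set g | W g /\ W (bracket f g)] by move=> g /sub[].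
apply: lin_span_min => [|g Xg]; last by split; [exact: XW|exact: fX].
have fB := Der_additive fD.
split=> [|a u v [Wu Wfu] [Wv Wfv]].
  by split; [exact: WL.1|rewrite bracket0r //; exact: WL.1].
split; first exact: WL.2.
rewrite bracketDr // bracketZr //; apply: subspaceD => //.
by apply: subspaceD => //; exact: subspaceZ.
Qed.

Lemma span_bracket_closed X : X `<=` Der K ->
  (forall f g, X f -> X g -> lin_span X (bracket f g)) ->
  forall f g, lin_span X f -> lin_span X g -> lin_span X (bracket f g).
Proof.
move=> XD XX f g Xf Xg; have spL := lin_span_subspace X.
have gD : Der K g by apply: (lin_span_min Der_subspace XD).
apply: subspace_bracketC => //; apply: (bracket_span (X := X)) => //.
  exact: sub_lin_span.
move=> h Xh; apply: subspace_bracketC => //.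
apply: (bracket_span (X := X)) => //; [exact: XD|exact: sub_lin_span|].
by move=> k Xk; exact: XX.
Qed.

Lemma eval_subspace c : subspace [set d : V | d c = 0].
Proof.
by split=> // a u v /= uc vc; rewrite !fctE uc vc scaler0 addr0.
Qed.

(** The field of constants of X is that of a finite K-basis of KX. *)
Lemma finite_constants n X : dep_mod [set 0] n X ->
  exists B, [/\ finite_set B, B `<=` X &
    forall c, (forall b, B b -> b c = 0) -> forall d, X d -> d c = 0].
Proof.
move=> /dep_basis[r [e [_ Xe Xspan]]]; exists (range e); split.
- by apply: finite_image; exact: finite_finset.
- by move=> _ [i _ <-].
- by move=> c ec d /Xspan; apply: (lin_span_min (eval_subspace c) ec).
Qed.

Lemma lie_ring_cut (L W : set V) : lie_ring L -> subspace W ->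
  (forall f g, W f -> W g -> W (bracket f g)) -> lie_ring (L `&` W).
Proof.
move=> [[L0 LB] Llie] WL Wlie; split; [split|].
- by split=> //; exact: WL.1.
- by move=> f g [Lf Wf] [Lg Wg]; split; [exact: LB|exact: (subspaceB WL Wf Wg)].
- by move=> f g [Lf Wf] [Lg Wg]; split; [exact: Llie|exact: Wlie].
Qed.

End DerivationSpace.

Section EngelDerivations.
Variables (K : fieldType) (L0 : set (K -> K)).
Local Notation V := (K -> K^o).
Hypothesis L0_Engel : Engel_ring L0.
Hypothesis L0_Der : L0 `<=` Der K.

Lemma common_zero_ad n r (M : set V) (X Y : set V) :
  M `<=` L0 -> X `<=` L0 -> jointly_nilpotent L0 M ->
  subspace Y -> (forall m v, M m -> Y v -> Y (bracket m v)) ->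
  (forall m v, M m -> X v -> X (bracket m v)) ->
  dep_mod [set 0] n M -> dep_mod Y r X -> (exists2 x, X x & ~ Y x) ->
  exists x, [/\ X x, ~ Y x & forall m, M m -> Y (bracket m x)].
Proof.
move=> ML0 XL0 nM YL MY MX Mn Xr XY.
have [B [Bf BM Bc]] := finite_constants Mn.
apply: (@common_zero K V M (@bracket K) X Y YL _ _ MY MX B Bf BM Bc _ r Xr XY).
- by move=> m u v Mm; apply: bracketDr; exact/Der_additive/L0_Der/ML0.
- by move=> m k v Mm; apply: bracketZr; exact/L0_Der/ML0.
- move=> S Sf SM x Xx; have [N Nx] := nM S Sf SM x (XL0 x Xx).
  by exists N; apply: killed_sub Nx => _ ->; exact: YL.1.
Qed.

(** An M-stable subspace W spanned by elements of M can be enlarged by any e in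
   M whose image modulo W is killed by M; the last step before KM is reached
   yields the hyperplane. *)
Lemma invariant_hyperplane n (M : set V) : lie_ring M -> M `<=` L0 ->
  jointly_nilpotent L0 M -> dep_mod [set 0] n M -> (exists2 m, M m & m <> 0) ->
  exists (W : set V) (e : V),
    [/\ subspace W, W `<=` lin_span (M `&` W),
        (forall m w, M m -> W w -> W (bracket m w)),
        [/\ M e, ~ W e & forall m, M m -> W (bracket m e)] &
        M `<=` add_line W e].
Proof.
move=> ML ML0 nM Mn M0.
suff ind r (W : set V) : subspace W -> W `<=` lin_span (M `&` W) ->
    (forall m w, M m -> W w -> W (bracket m w)) -> (exists2 m, M m & ~ W m) ->
    dep_mod W r M ->
    exists (W : set V) (e : V),
    [/\ subspace W, W `<=` lin_span (M `&` W),
        (forall m w, M m -> W w -> W (bracket m w)),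
        [/\ M e, ~ W e & forall m, M m -> W (bracket m e)] &
        M `<=` add_line W e].
  apply: (ind n [set 0]) => //; first exact: subspace0.
  - by move=> _ ->; exact: (lin_span_subspace _).1.
  - by move=> m _ Mm ->; apply: bracket0r; exact/Der_additive/L0_Der/ML0.
elim: r W => [|r IH] W WL Wspan MW MnW Wr.
  case: MnW => m Mm Wm; have [|k [[i]]] := Wr (fun=> m); first by [].
  rewrite (ord1 i) big_ord1 => /eqP k0 /(subspace_scale_eq0 WL Wm) //.
have MM m v : M m -> M v -> M (bracket m v) by case: ML => _; apply.
have [e [Me We eW]] := common_zero_ad ML0 ML0 nM WL MW MM Mn Wr MnW.
have [Mline|] := pselect (M `<=` add_line W e); first by exists W, e; split.
move=> /existsNP[m /not_implyP[Mm mW]].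
have lineL := add_line_subspace e WL.
apply: (IH (add_line W e)) => //.
- move=> v [k Wv]; rewrite -[v](subrK (k *: e)).
  have spL := lin_span_subspace (M `&` add_line W e).
  apply: subspaceD => //; last first.
    by apply: subspaceZ => //; apply: sub_lin_span; split=> //; exact: mem_add_line.
  apply: (lin_span_min spL _ (Wspan _ Wv)) => w [Mw Ww]; apply: sub_lin_span.
  by split=> //; exact: sub_add_line.
- move=> d v Md [k Wv]; rewrite -[v](subrK (k *: e)).
  have dD := L0_Der (ML0 _ Md).
  rewrite bracketDr ?bracketZr //; last exact: Der_additive.
  apply: subspaceD => //; first by apply: sub_add_line => //; exact: MW.
  apply: subspaceD => //; first by apply: subspaceZ => //; exact: mem_add_line.
  by apply: subspaceZ => //; apply: sub_add_line => //; exact: eW.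
- by exists m.
- exact: dep_mod_add_line.
Qed.

End EngelDerivations.

(** * One-forms on derivations *)

Section OneForms.
Variable K : fieldType.
Local Notation V := (K -> K^o).
Local Notation form := ((K -> K) -> K^o).
Implicit Types (m f : V) (M : set V) (phi psi : form) (c a : K).

(** One-forms are encoded as functions on all maps K -> K, and equality of forms
   on KM as equality of their values on M, through [vanishing]. *)
Definition Lie_derivative m phi : form :=
  fun f => m (phi f) - phi (bracket m f).

(** The differential of c. *)
Definition exact_form c : form := fun f => f c.

Definition vanishing M : set form := [set phi | forall f, M f -> phi f = 0].

Lemma vanishing_subspace M : subspace (vanishing M).
Proof.
by split=> // a phi psi p0 q0 f Mf; rewrite !fctE p0 // q0 // scaler0 addr0.
Qed.

Lemma Lie_derivativeD m phi psi : zmod_morphism m ->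
  Lie_derivative m (phi + psi) = Lie_derivative m phi + Lie_derivative m psi.
Proof.
move=> mB; apply/funext => f; rewrite /Lie_derivative !fctE.
by rewrite (zmod_morphD _ _ mB) opprD addrACA.
Qed.

Lemma Lie_derivativeZ m a phi : Der K m ->
  Lie_derivative m (a *: phi) = m a *: phi + a *: Lie_derivative m phi.
Proof.
move=> [_ mM]; apply/funext => f; rewrite /Lie_derivative !fctE /GRing.scale /=.
by rewrite mM; ring.
Qed.

(** The Lie derivative commutes with the exterior derivative. *)
Lemma Lie_derivative_exact m c :
  Lie_derivative m (exact_form c) = exact_form (m c).
Proof.
apply/funext => f; rewrite /Lie_derivative /exact_form /bracket !fctE /=.
by rewrite opprB addrC subrK.
Qed.

(** Evaluated on a K-basis of KM, n + 1 forms give a matrix with more rows than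
   columns. *)
Lemma exact_form_dep n M : dep_mod [set 0] n M ->
  dep_mod (vanishing M) n (range exact_form).
Proof.
move=> /dep_basis[r [e [rn _ Mspan]]] phi phiE.
have /choice[c cE] : forall i, exists c, exact_form c = phi i.
  by move=> i; have [c _ <-] := phiE i; exists c.
have [k k0 kC] :=
  left_kernel_neq0 (\matrix_(i, j) e j (c i)) (rn : (r < n.+1)%N).
exists (fun i => k 0 i); split=> // f /Mspan.
have -> : (\sum_i k 0 i *: phi i) f = \sum_i k 0 i * f (c i).
  by rewrite fct_sumE; apply: eq_bigr => i _; rewrite -cE.
apply: (@lin_span_min _ _ _ [set f : V | \sum_i k 0 i * f (c i) = 0]).
  split=> [|a u v /= u0 v0]; first by rewrite /= big1 // => i _; rewrite mulr0.
  have -> : \sum_i k 0 i * (a *: u + v) (c i) =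
      a * (\sum_i k 0 i * u (c i)) + \sum_i k 0 i * v (c i).
    rewrite mulr_sumr -big_split; apply: eq_bigr => i _ /=.
    by rewrite !fctE mulrDr /GRing.scale /= mulrCA.
  by rewrite u0 v0 mulr0 addr0.
move=> _ [j _ <-] /=; have := congr1 (fun A : 'rV_r => A 0 j) kC.
rewrite !mxE => kj.
by rewrite -[RHS]kj; apply: eq_bigr => i _; rewrite mxE.
Qed.

End OneForms.

(** * Engel rings of derivations of finite rank *)

Section MainStep.
Variables (K : fieldType) (L0 : set (K -> K)).
Local Notation V := (K -> K^o).
Hypothesis L0_Engel : Engel_ring L0.
Hypothesis L0_Der : L0 `<=` Der K.
Variables (n : nat) (L M : set V).
Hypothesis (L_lie : lie_ring L) (LL0 : L `<=` L0).
Hypothesis Ldep : dep_mod [set 0] n.+1 L.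
Hypothesis (M_lie : lie_ring M) (ML : M `<=` L) (nM : jointly_nilpotent L0 M).
Hypothesis M_max : forall U : set V, lie_ring U -> U `<=` L -> M `<=` U ->
  jointly_nilpotent L0 U -> U `<=` M.
Hypothesis IHn : forall P : set V, lie_ring P -> P `<=` L ->
  dep_mod [set 0] n P -> jointly_nilpotent L0 P.

Let ML0 : M `<=` L0. Proof. by move=> f /ML/LL0. Qed.
Let MD : M `<=` Der K. Proof. by move=> f /ML0/L0_Der. Qed.
Let Mdep : dep_mod [set 0] n.+1 M. Proof. exact: dep_mod_sub Ldep. Qed.
Let LM m v : M m -> L v -> L (bracket m v).
Proof. by move=> /ML; case: L_lie => _; apply. Qed.
Let MM m v : M m -> M v -> M (bracket m v).
Proof. by case: M_lie => _; apply. Qed.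

(** Here M is all of L inside KM, by induction on the rank, and a common zero of
   M on L modulo KM does the job. *)
Lemma normaliser_grows_span : (exists2 x, L x & ~ lin_span M x) ->
  exists x, [/\ L x, ~ M x & forall m, M m -> M (bracket m x)].
Proof.
move=> [x0 Lx0 Mx0]; have spL := lin_span_subspace M.
have Mspan m v : M m -> lin_span M v -> lin_span M (bracket m v).
  move=> Mm; apply: bracket_span => //; [exact: MD|exact: sub_lin_span|].
  by move=> g Mg; apply: sub_lin_span; exact: MM.
have cutM : L `&` lin_span M `<=` M.
  have cutL : lie_ring (L `&` lin_span M).
    apply: lie_ring_cut => //; apply: span_bracket_closed => // f g Mf Mg.
    by apply: sub_lin_span; exact: MM.
  have cutsub : L `&` lin_span M `<=` L by move=> f [].
  apply: (M_max cutL cutsub).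
    by move=> f Mf; split; [exact: ML|exact: sub_lin_span].
  exact: IHn cutL cutsub (dep_mod_cut spL Lx0 Mx0 Ldep).
have Lmod : dep_mod (lin_span M) n.+1 L.
  by apply: dep_mod_sub Ldep => // _ ->; exact: spL.1.
have [|x [Lx Mx xM]] := common_zero_ad L0_Der ML0 LL0 nM spL Mspan LM
  Mdep Lmod; first by exists x0.
exists x; split=> // [/sub_lin_span//|m Mm].
by apply: cutM; split; [exact: LM|exact: xM].
Qed.

(** Here L and M have the same rank, hence the same constants C; the ring of
   the x whose coefficient lam(x) on the line KM / W is a constant is jointly
   nilpotent, hence equal to M, and a common zero of M on the forms d(lam x)
   does the job. *)
Lemma normaliser_grows_full : L `<=` lin_span M -> (exists2 x, L x & ~ M x) ->
  exists x, [/\ L x, ~ M x & forall m, M m -> M (bracket m x)].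
Proof.
move=> Lspan [x0 Lx0 Mx0].
have M0 : exists2 m, M m & m <> 0.
  apply: contrapT => M0; apply: Mx0.
  suff -> : x0 = 0 by exact: M_lie.1.1.
  apply: (lin_span_min (@subspace0 K V) _ (Lspan _ Lx0)) => m Mm.
  by apply: contrapT => m0; apply: M0; exists m.
have [W [e [WL Wspan MW [Me We eW] Mline]]] :=
  invariant_hyperplane L0_Der M_lie ML0 nM Mdep M0.
have Lline : L `<=` add_line W e.
  by move=> x /Lspan; apply: lin_span_min => //; exact: add_line_subspace.
have MWD : M `&` W `<=` Der K by move=> f [/MD].
have WW f g : W f -> W g -> W (bracket f g).
  move=> Wf Wg; apply: (lin_span_min WL (S := M `&` W)) => [h []//|].
  apply: span_bracket_closed; [by []| |exact: Wspan|exact: Wspan].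
  move=> h k [Mh Wh] [Mk Wk]; apply: sub_lin_span.
  by split; [exact: MM|exact: MW].
have /choice[lam lamE] : forall x : V, exists k, L x -> W (x - k *: e).
  move=> x; have [Lx|Lx] := pselect (L x); last by exists 0.
  by have [k Wk] := Lline x Lx; exists k.
have lam_uniq x k : L x -> W (x - k *: e) -> lam x = k.
  move=> Lx Wk; apply/eqP; rewrite -subr_eq0; apply/eqP.
  apply: (subspace_scale_eq0 WL We).
  have -> : (lam x - k) *: e = (x - k *: e) - (x - lam x *: e).
    by rewrite scalerBl opprB [RHS]addrC addrA subrK.
  by apply: subspaceB => //; exact: lamE.
have lam0 x : L x -> W x -> lam x = 0.
  by move=> Lx Wx; apply: lam_uniq => //; rewrite scale0r subr0.
have brW m x : M m -> L x -> W (bracket m x - m (lam x) *: e).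
  move=> Mm Lx; have mD := MD Mm.
  rewrite -[in bracket m x](subrK (lam x *: e : V) x) bracketDr; last first.
    exact: Der_additive.
  rewrite bracketZr // addrA addrAC addrK.
  apply: subspaceD => //; last by apply: subspaceZ => //; exact: eW.
  by apply: MW => //; exact: lamE.
have lam_eq m x : M m -> L x -> lam (bracket m x) = m (lam x).
  by move=> Mm Lx; apply: lam_uniq; [exact: LM|exact: brW].
(* constants of M, hence of KM, hence of L *)
pose const c := forall m, M m -> m c = 0.
have const_span c : const c -> forall d, lin_span M d -> d c = 0.
  by move=> cc; apply: (lin_span_min (eval_subspace c)).
have lamM m : M m -> const (lam m).
  move=> Mm; have evL := eval_subspace (lam m).
  have ez : e (lam m) = 0.
    rewrite -(lam_eq _ _ Me (ML Mm)) lam0 //; first exact: LM Me (ML Mm).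
    by apply: subspace_bracketC => //; exact: eW.
  have Wz w : W w -> w (lam m) = 0.
    move=> /Wspan; apply: (lin_span_min evL) => b [Mb Wb] /=.
    rewrite -(lam_eq _ _ Mb (ML Mm)) lam0 //; first exact: LM Mb (ML Mm).
    by apply: subspace_bracketC => //; exact: MW.
  move=> m' /Mline[k Wk]; rewrite -[m'](subrK (k *: e : V)).
  by rewrite fctE Wz // add0r fctE ez scaler0.
(* modulo W these x are multiples of e by constants, so they bracket into W *)
pose U := [set x | L x /\ const (lam x)].
have MU : M `<=` U by move=> m Mm; split; [exact: ML|exact: lamM].
have UM x m : U x -> M m -> W (bracket m x).
  by move=> [Lx cx] Mm; have := brW m x Mm Lx; rewrite cx // scale0r subr0.
have UU x y : U x -> U y -> W (bracket x y).
  move=> Ux [Ly cy]; have xD : Der K x by apply/L0_Der/LL0; case: Ux.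
  rewrite -[y](subrK (lam y *: e : V)) bracketDr; last exact: Der_additive.
  apply: subspaceD => //.
    apply: (bracket_span (X := M `&` W)) => //.
      by move=> p [Mp Wp]; apply: subspace_bracketC => //; exact: UM.
    by apply: Wspan; exact: lamE.
  rewrite bracketZr // const_span //; last by apply: Lspan; case: Ux.
  rewrite scale0r add0r; apply: subspaceZ => //.
  by apply: subspace_bracketC => //; exact: UM.
have U_lie : lie_ring U.
  have L00 : L 0 by exact: L_lie.1.1.
  have m0 m : M m -> m 0 = 0.
    by move=> Mm; apply: zmod_morph0; exact: Der_additive (MD Mm).
  split; [split|].
  - by split=> // m Mm; rewrite lam0 //; [exact: m0|exact: WL.1].
  - move=> x y [Lx cx] [Ly cy]; have Lxy := L_lie.1.2 _ _ Lx Ly.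
    split=> // m Mm.
    have -> : lam (x - y) = lam x - lam y.
      apply: lam_uniq => //.
      have -> : (x - y : V) - (lam x - lam y) *: e =
          (x - lam x *: e) - (y - lam y *: e).
        rewrite scalerBl !opprB [LHS]addrACA [RHS]addrACA.
        by congr (_ + _); rewrite addrC.
      exact: subspaceB WL (lamE _ Lx) (lamE _ Ly).
    by rewrite (Der_additive (MD Mm)) cx // cy // subrr.
  - move=> x y Ux Uy; have Lxy : L (bracket x y).
      by apply: L_lie.2; [case: Ux|case: Uy].
    by split=> // m Mm; rewrite lam0 //; [exact: m0|exact: UU].
have UsubM : U `<=` M.
  have LWlie := lie_ring_cut L_lie WL WW.
  have LWsub : L `&` W `<=` L by move=> x [].
  have UL : U `<=` L by move=> x [].
  apply: (M_max U_lie UL MU).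
  apply: (jointly_nilpotent_ideal L0_Engel U_lie _ LWlie).
  - by move=> x [/LL0].
  - move=> x [Lx Wx]; split=> // m Mm; rewrite lam0 //.
    by apply: zmod_morph0; exact: Der_additive (MD Mm).
  - by move=> x y Ux Uy; split; [apply: L_lie.2; [case: Ux|case: Uy]|exact: UU].
  - exact: IHn LWlie LWsub (dep_mod_cut WL (ML Me) We Ldep).
have [B [Bf BM Bc]] := finite_constants Mdep.
pose X := [set exact_form (lam x) | x in L].
have Xdep : dep_mod (vanishing M) n.+1 X.
  by apply: dep_mod_sub (exact_form_dep Mdep) => // _ [x _ <-]; exists (lam x).
have [| | | | | |_ [[x Lx <-] van xM]] := @common_zero K _ M (@Lie_derivative K)
    X (vanishing M) (vanishing_subspace M) _ _ _ _ B Bf BM Bc _ n.+1 Xdep.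
- by move=> m u v Mm; apply: Lie_derivativeD; exact/Der_additive/MD.
- by move=> m k v Mm; apply: Lie_derivativeZ; exact: MD.
- move=> m v Mm v0 f Mf.
  rewrite /Lie_derivative v0 // v0 ?subr0; last exact: MM.
  by apply: zmod_morph0; exact/Der_additive/MD.
- move=> m _ Mm [x Lx <-]; exists (bracket m x); first exact: LM.
  by rewrite Lie_derivative_exact lam_eq.
- move=> S Sf SM _ [x Lx <-]; have [N] := nM Sf SM (LL0 Lx) => xN; exists N.
  elim: N x Lx xN => [|N IH] x Lx /= xk.
    move=> f Mf; rewrite xk lam0 //; [|exact: L_lie.1.1|exact: WL.1].
    by apply: zmod_morph0; exact/Der_additive/MD.
  move=> s Ss; rewrite Lie_derivative_exact -lam_eq //; last exact: SM.
  by apply: IH; [apply: LM => //; exact: SM|exact: xk].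
- exists (exact_form (lam x0)); first by exists x0.
  by move=> van; apply: Mx0; apply: UsubM; split.
exists x; split=> // [Mx|m Mm].
  by apply: van => m Mm; exact: lamM.
apply: UsubM; split; first exact: LM.
move=> f Mf; rewrite lam_eq //.
by have := xM m Mm f Mf; rewrite Lie_derivative_exact.
Qed.

End MainStep.

(** The ambient ring L0 stays fixed during the induction on n, so that the
   induction hypothesis for a subring P of L controls the action of P on all of
   L0 and not only on P. *)
Theorem finite_dim_jointly_nilpotent (K : fieldType) (L0 : set (K -> K)) n
    (L : set (K -> K^o)) : Engel_ring L0 -> L0 `<=` Der K ->
  lie_ring L -> L `<=` L0 -> dep_mod [set 0] n L -> jointly_nilpotent L0 L.
Proof.
move=> L0_Engel L0_Der; elim: n L => [|n IH] L L_lie LL0 Ldep.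
  move=> S Sf SL; apply: (jointly_nilpotent0 L0_Engel) => // s /SL Ls.
  have [|k [[i]]] := Ldep (fun=> s); first by [].
  rewrite (ord1 i) big_ord1 => k0 /eqP.
  by rewrite scaler_eq0 (negbTE k0) => /eqP.
have [M [M_lie ML nM M_max M_norm]] := 
  maximal_jointly_nilpotent L0_Engel L_lie LL0.
suff LM : L `<=` M by move=> S Sf SL; apply: nM => // s /SL; exact: LM.
move=> x0 Lx0; apply: contrapT => Mx0.
have IHL (P : set (K -> K^o)) : lie_ring P -> P `<=` L -> dep_mod [set 0] n P ->
    jointly_nilpotent L0 P.
  by move=> P_lie PL; apply: IH => // f /PL/LL0.
have [x [Lx Mx xM]] : exists x,
    [/\ L x, ~ M x & forall m, M m -> M (bracket m x)].
  have [Lspan|] := pselect (L `<=` lin_span (M : set (K -> K^o))).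
    apply: (normaliser_grows_full L0_Engel L0_Der L_lie LL0 Ldep M_lie ML nM)
      => //.
    by exists x0.
  move=> /existsNP[x /not_implyP[Lx Mx]].
  apply: (normaliser_grows_span L0_Der L_lie LL0 Ldep M_lie ML nM) => //.
  by exists x.
apply: Mx; apply: M_norm => // m Mm; rewrite bracketC.
by apply: subgroupN; [case: M_lie|exact: xM].
Qed.

(** * From local nilpotency to the Engel condition *)

Section EngelCondition.
Variables (V : zmodType).
Implicit Types (d x : V -> V) (L : set (V -> V)).

(** Induction on the exponent n with d^n a = 0.  Put y_k = (ad d)^k x; then
   y_(k+1) (a) = d (y_k a) - y_k (d a), where the last term vanishes for large k
   by induction, so that the values y_k (a) are eventually the iterates of d at
   one element. *)
Lemma iter_ad_eval0 L d x a : L `<=` @zmod_morphism V V -> lie_ring L ->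
  (forall v, exists n, iter n d v = 0) -> L d -> L x ->
  exists N, forall k, (N <= k)%N -> iter k (bracket d) x a = 0.
Proof.
move=> Ladd Llie dnil Ld Lx; have d0 := zmod_morph0 (Ladd _ Ld).
have Ly k : L (iter k (bracket d) x).
  by elim: k => //= k Lk; case: Llie => _; apply.
have [n] := dnil a; elim: n a => [|n IH] a.
  by move=> /= ->; exists 0%N => k _; exact/zmod_morph0/Ladd.
rewrite iterSr => /IH[N Nda].
have step k : (N <= k)%N ->
    iter k.+1 (bracket d) x a = d (iter k (bracket d) x a).
  by move=> Nk; rewrite iterS {1}/bracket !fctE /= Nda // subr0.
have iterstep i :
    iter (i + N) (bracket d) x a = iter i d (iter N (bracket d) x a).
  by elim: i => //= i <-; rewrite -step ?leq_addl.
have [m m0] := dnil (iter N (bracket d) x a); exists (m + N)%N => k mNk.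
rewrite -(subnK mNk) addnA iterstep iterD m0.
by elim: (_ - _)%N => //= i ->.
Qed.

Lemma Engel_of_separating_points L r (a : 'I_r -> V) :
  L `<=` @zmod_morphism V V -> lie_ring L ->
  (forall d, L d -> forall v, exists n, iter n d v = 0) ->
  (forall d, L d -> (forall j, d (a j) = 0) -> d = 0) ->
  Engel_ring L.
Proof.
move=> Ladd Llie Lnil sep; split=> // d x Ld Lx.
have [N Na] : exists N, forall v, range a v ->
    forall k, (N <= k)%N -> iter k (bracket d) x v = 0.
  apply: finite_bound => [|v m n _ mn mv k nk|v _].
  - by apply: finite_image; exact: finite_finset.
  - by apply: mv; exact: leq_trans nk.
  - exact: iter_ad_eval0 (Lnil d Ld) Ld Lx.
exists N; apply: sep => [|j]; last by apply: Na => //; exists j.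
by elim: (N) => //= k Lk; case: Llie => _; apply.
Qed.

End EngelCondition.

(** * Passage to the field of fractions *)

Section Fractions.
Variables (A : idomainType) (L : set (A -> A)).
Local Notation K := {fraction A}.
Hypotheses (L_der : L `<=` Der A) (L_lie : lie_ring L).

Lemma frac_ext_exists d : L d -> exists2 D, frac_ext L D & extends_to_frac d D.
Proof.
move=> Ld; have [D [[DK dD] _]] := der_extends_uniquely (L_der Ld).
by exists D => //; split=> //; exists d.
Qed.

Lemma extends_bracket (d f : A -> A) (D F : K -> K) :
  extends_to_frac d D -> extends_to_frac f F ->
  extends_to_frac (bracket d f) (bracket D F).
Proof. by move=> dD fF a; rewrite /bracket !fctE /= dD fF fF dD tofracB. Qed.

Lemma extends_eq0 (d : A -> A) (D : K -> K) :
  extends_to_frac d D -> (forall a, D (tofrac a) = 0) -> d = 0.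
Proof.
move=> dD D0; apply/funext => a; apply/eqP; rewrite -tofrac_eq0 -dD D0.
by rewrite eqxx.
Qed.

Lemma Der_extends0 (D : K -> K) :
  Der K D -> extends_to_frac (0 : A -> A) D -> D = 0.
Proof.
move=> DK D0; have [E [_ Euniq]] := der_extends_uniquely (lie_ring_Der A).1.1.
rewrite -(Euniq D) //; apply: Euniq; split; first exact: (lie_ring_Der K).1.1.
by move=> a; rewrite tofrac0.
Qed.

Lemma frac_ext_lie_ring : lie_ring (frac_ext L).
Proof.
have [[DK0 DKB] DKlie] := lie_ring_Der K.
split; [split|].
- split=> //; exists 0; first exact: L_lie.1.1.
  by move=> a; rewrite tofrac0.
- move=> D F [DK [d Ld dD]] [FK [f Lf fF]]; split; first exact: DKB.
  exists (d - f); first exact: L_lie.1.2.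
  by move=> a; rewrite !fctE dD fF tofracB.
- move=> D F [DK [d Ld dD]] [FK [f Lf fF]]; split; first exact: DKlie.
  by exists (bracket d f); [exact: L_lie.2|exact: extends_bracket].
Qed.

Lemma frac_ext_dep : finite_dimensional (frac_span L) ->
  exists n, dep_mod [set 0] n (frac_ext L : set (K -> K^o)).
Proof.
move=> [n [e [_ spe]]]; exists n.
apply: (dep_mod_sub _ _ (lin_span_dep (e := e))) => // D LD.
by apply: spe; exact: sub_lin_span.
Qed.

(** A combination D of e_1, ..., e_n takes at b the value given by its
   coefficients and the row (e_1 b, ..., e_n b); points whose rows span all
   these rows separate. *)
Lemma finite_separating_points : finite_dimensional (frac_span L) ->
  exists r (a : 'I_r -> A), forall d, L d -> (forall j, d (a j) = 0) -> d = 0.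
Proof.
move=> [n [e [_ spe]]].
pose row (a : A) : 'rV[K]_n := \row_i e i (tofrac a).
have rows_dep : dep_mod [set 0] n (range row).
  move=> x _.
  have [k k0 kC] := left_kernel_neq0 (\matrix_(i, j) x i 0 j) (ltnSn n).
  exists (fun i => k 0 i); split=> //=; apply/rowP => j.
  have := congr1 (fun B : 'rV_n => B 0 j) kC; rewrite !mxE summxE => kj.
  by rewrite -[RHS]kj; apply: eq_bigr => i _; rewrite !mxE.
have [r [w [_ roww wspan]]] := dep_basis rows_dep.
have /choice[a aw] : forall j, exists a, row a = w j.
  by move=> j; have [a _ <-] := roww j; exists a.
exists r, a => d Ld d0; have [D LD dD] := frac_ext_exists Ld.
apply: (extends_eq0 dD) => b.
have /lin_span_rangeP[c DE] : lin_span (range e) D.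
  by apply: spe; exact: sub_lin_span.
have Drow v : D (tofrac v) = \sum_i c i * row v 0 i.
  by rewrite DE fct_sumE; apply: eq_bigr => i _; rewrite mxE.
have Dspan : lin_span (range w) `<=` [set u : 'rV_n | \sum_i c i * u 0 i = 0].
  apply: lin_span_min.
    split=> [|k u v /= u0 v0].
      by rewrite /= big1 // => i _; rewrite mxE mulr0.
    have -> : \sum_i c i * (k *: u + v) 0 i =
        k * (\sum_i c i * u 0 i) + \sum_i c i * v 0 i.
      rewrite mulr_sumr -big_split; apply: eq_bigr => i _ /=.
      by rewrite !mxE mulrDr mulrCA.
    by rewrite u0 v0 mulr0 addr0.
  by move=> _ [j _ <-] /=; rewrite -aw -Drow dD d0 tofrac0.
by rewrite Drow; apply: Dspan; apply: wspan; exists b.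
Qed.

Lemma frac_ext_Engel : Engel_ring L -> Engel_ring (frac_ext L).
Proof.
move=> [_ _ Eng]; split; first by move=> D [[]].
  exact: frac_ext_lie_ring.
move=> D F [DK [d Ld dD]] [FK [f Lf fF]]; have [N N0] := Eng d f Ld Lf.
exists N; apply: Der_extends0.
  by elim: N {N0} => //= N; exact: (lie_ring_Der K).2.
by rewrite -N0; elim: N {N0} => //= N; exact: extends_bracket.
Qed.

(** Extension to K is an injective morphism of Lie rings. *)
Lemma jointly_nilpotent_restrict :
  jointly_nilpotent (frac_ext L) (frac_ext L) -> jointly_nilpotent L L.
Proof.
move=> nL S Sf SL f Lf.
have /choice[ext extP] : forall d, exists D, L d ->
    frac_ext L D /\ extends_to_frac d D.
  move=> d; have [Ld|] := pselect (L d); last by exists 0.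
  by have [D] := frac_ext_exists Ld; exists D.
have [F LF fF] := frac_ext_exists Lf.
have [|N NF] := nL (ext @` S) (finite_image ext Sf) _ F LF.
  by move=> _ [s /SL/extP[] ? _ <-].
exists N; elim: N f F fF NF {Lf LF} => [|N IH] f F fF /= NF.
  by apply: (extends_eq0 fF); rewrite NF.
move=> s Ss; have [_ sE] := extP s (SL s Ss).
apply: (IH _ (bracket (ext s) F)); first exact: extends_bracket.
by apply: NF; exists s.
Qed.

End Fractions.

Theorem theorem1p5 (A : idomainType) (L : set (A -> A))
    (L_der : L `<=` Der A)
    (L_lie : lie_ring L)
    (L_nil : forall d, L d -> locally_nilpotent_map d)
    (L_fin : finite_dimensional (frac_span L)) :
  locally_nilpotent_lie_ring L.
Proof.
have [r [a sep]] := finite_separating_points L_der L_fin.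
have LE : Engel_ring L.
  apply: (Engel_of_separating_points (a := a)) => //.
    by move=> d /L_der[].
  by move=> d Ld v; have [n _ nv] := L_nil d Ld v; exists n.
have [n Ldep] := frac_ext_dep L_fin.
have nL : jointly_nilpotent L L.
  apply: jointly_nilpotent_restrict => //.
  apply: (finite_dim_jointly_nilpotent _ _ _ _ Ldep) => //.
  - exact: frac_ext_Engel.
  - by move=> D [].
  - exact: frac_ext_lie_ring.
move=> M _ ML [S Sf ME]; rewrite ME in ML *.
have SL : S `<=` L by move=> s Ss; apply: ML; exact: sub_gen_smallest.
apply: (jointly_nilpotent_lie_gen LE) => // T Tf TS.
by apply: nL => // t /TS/SL.
Qed.
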